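(* Let $G$ be an xQuAD publisher game whose aspect distribution $P$ is symmetric (and not concentrated on a single point). Then for every publisher $i\in\{1,\dots,n\}$ the relevance strategy $\mathbb{E}_{P}[x_a]$ is a dominant strategy.
   Context: Let $n,k\ge 1$ be integers, $N=\{1,\dots,n\}$ the set of publishers (players), and $\mathbb{X}=[0,1]^k$ with the Euclidean norm. Each publisher $i$ chooses a document (strategy) $x_i\in\mathbb{X}$; a strategy profile is $x=(x_1,\dots,x_n)\in\mathbb{X}^n$, and $x_{-i}$ is the profile without its $i$-th entry. The aspect distribution $P$ is a probability distribution (discrete or continuous) on $\mathbb{X}$; $x_a$ denotes a random aspect representation drawn from $P$, and $\mathbb{E}_P$ is expectation over it. Similarity: $s(x,y)=1-\frac1k\|x-y\|^2\in[0,1]$, and $s_i^a=s(x_i,x_a)$. Symmetric distribution: $P$ is symmetric if for every $d\ge0$, $\mathbb{E}_P[x_a\mid \|\mathbb{E}_P[x_a]-x_a\|=d]=\mathbb{E}_P[x_a]$ (understood in the usual sense of conditional expectation, i.e. for distances $d$ that occur). Ranking: given a score function $f(x_i,P,L)$, where $L$ is the list of documents already ranked, positions $j=1,\dots,n$ are filled successively: position $j$ is given to the not-yet-ranked document $l_j$ maximizing $f(x_i,P,L_{j-1})$, where $L_0=\emptyset$ and $L_j$ is $L_{j-1}$ followed by $l_j$. Ties are broken lexicographically (smallest publisher index first). $r_i$ denotes the position of publisher $i$, and $l_j$ the publisher at position $j$. xQuAD score, with parameter $\lambda\in(0,1)$: $$f_{xQuAD}(x_i,P,L)=\lambda\,\mathbb{E}_P[s_i^a]+(1-\lambda)\,\mathbb{E}_P\Big[s_i^a\prod_{i'\in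 L}(1-s_{i'}^a)\Big]$$ (empty product $=1$). The xQuAD publisher game is the game with this ranking (lexicographic tie-breaking) and publisher utilities $$u_i(x)=\mathbb{E}_P\Big[s_i^a\prod_{j'<r_i}(1-s_{l_{j'}}^a)\Big].$$ Dominant strategy: $x_i$ is a dominant strategy of publisher $i$ if for every $x_i'\in\mathbb{X}$ with $x_i'\ne x_i$ and every $x_{-i}\in\mathbb{X}^{n-1}$, $u_i(x_i,x_{-i})>u_i(x_i',x_{-i})$. *)

(* Defs.v *)
From HB Require Import structures.
From mathcomp Require Import all_boot all_order all_algebra.
From mathcomp Require Import all_classical all_reals all_analysis.

Set Implicit Arguments.
Unset Strict Implicit.
Unset Printing Implicit Defensive.

Import Order.TTheory GRing.Theory Num.Theory.
Local Open Scope classical_set_scope.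
Local Open Scope ring_scope.

(* Points of R^k are k-tuples, which carry the product of the Borel
   sigma-algebras. (The library's norm on row vectors is the sup norm, hence
   the explicit Euclidean distance.) *)
Definition edist (R : realType) (k : nat) (x y : k.-tuple R) : R :=
  Num.sqrt (\sum_(j < k) (tnth x j - tnth y j) ^+ 2).

Definition cube (R : realType) (k : nat) : set (k.-tuple R) :=
  [set x | forall j, 0 <= tnth x j <= 1].

Definition similarity (R : realType) (k : nat) (x y : k.-tuple R) : R :=
  1 - k%:R^-1 * edist x y ^+ 2.

Section Expectation.
Context {R : realType} {k : nat} (P : probability (k.-tuple R) R).

(* Real-valued; the expectations taken below are all finite when P is supported
   by the cube. *)
Definition Ex (X : k.-tuple R -> R) : R := fine ('E_P[X])%E.

Definition mean : k.-tuple R := [tuple Ex (fun a => tnth a j) | j < k].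

(* d |-> g d is a version of the conditional expectation E[X | Y = d]. *)
Definition cond_expectation (X Y : k.-tuple R -> R) (g : R -> R) : Prop :=
  [/\ P.-integrable setT (EFin \o X),
      measurable_fun setT g,
      P.-integrable setT (EFin \o (g \o Y)) &
      forall B : set R, measurable B ->
        (\int[P]_(a in Y @^-1` B) (X a)%:E =
         \int[P]_(a in Y @^-1` B) (g (Y a))%:E)%E].

(* Stated coordinatewise. For an atom d of the law of the distance to the mean
   this gives the elementary E[x_a | dist = d] = mean; for a law without atoms
   conditional expectations are only defined up to a null set of d's, so the
   condition is that the constant function is a version. *)
Definition symmetric_distribution : Prop :=
  forall j : 'I_k,
    cond_expectation (fun a => tnth a j) (edist mean) (fun=> tnth mean j).

End Expectation.

Section Ranking.
Context {R : realType} {k n : nat}.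
Variable f : k.-tuple R -> seq (k.-tuple R) -> R.
Variable x : 'I_n -> k.-tuple R.

(* L lists the publishers already ranked, in order; [pick] would not promise the
   smallest maximizer by specification, so the tie-breaking is explicit. *)
Definition next_publisher (L : seq 'I_n) : option 'I_n :=
  [pick i | (i \notin L) &&
    [forall j, (j \notin L) ==>
       let fi := f (x i) (map x L) in
       let fj := f (x j) (map x L) in
       (fj < fi) || ((fj == fi) && (i <= j)%N)]].

Fixpoint ranked (m : nat) : seq 'I_n :=
  if m is m'.+1 then
    oapp (rcons (ranked m')) (ranked m') (next_publisher (ranked m'))
  else [::].

Definition ranking : seq 'I_n := ranked n.

(* Positions are counted from 0. *)
Definition position (i : 'I_n) : nat := index i ranking.

Definition ranked_before (i : 'I_n) : seq 'I_n := take (position i) ranking.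

End Ranking.

Definition xQuAD_score (R : realType) (k : nat) (lambda : R)
    (P : probability (k.-tuple R) R)
    (y : k.-tuple R) (L : seq (k.-tuple R)) : R :=
  lambda * Ex P (similarity y) +
  (1 - lambda) *
    Ex P (fun a => similarity y a * \prod_(z <- L) (1 - similarity z a)).

Definition xQuAD_utility (R : realType) (k n : nat) (lambda : R)
    (P : probability (k.-tuple R) R)
    (x : 'I_n -> k.-tuple R) (i : 'I_n) : R :=
  Ex P (fun a => similarity (x i) a *
    \prod_(j <- ranked_before (xQuAD_score lambda P) x i)
      (1 - similarity (x j) a)).

(* [eta x with i |-> s] is the profile (s, x_{-i}); the i-th entry of x itself is
   irrelevant. *)
Definition dominant_strategy (R : realType) (k n : nat)
    (u : ('I_n -> k.-tuple R) -> 'I_n -> R) (i : 'I_n) (s : k.-tuple R) :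
    Prop :=
  cube s /\
  forall s' : k.-tuple R, cube s' -> s' <> s ->
  forall x : 'I_n -> k.-tuple R, (forall j, j != i -> cube (x j)) ->
    u [eta x with i |-> s'] i < u [eta x with i |-> s] i.

(* Main.v *)
(** Write m for the mean and V(a) = 1 - s(m, a) = |m - a|^2 / k. Since V is a
    function of the distance to m, symmetry kills the cross term of |y - a|^2
    expanded around m, so that for every c
      E[s(y, a) V(a)^c] = E[s(m, a) V(a)^c] - |y - m|^2 / k * E[V(a)^c].
    Hence, as long as only documents equal to m have been ranked, m has a
    strictly larger score than any other document, so the publishers playing m
    are ranked first, in the order of their indices. If publisher i plays m, his
    utility is E[s(m, a) V(a)^r], where r of the others playing m have a smaller
    index; if he plays y <> m, all c >= r of them precede him and his utility is
    at most E[s(y, a) V(a)^c], which is smaller by at least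
    |y - m|^2 / k * E[V(a)^c] > 0. *)
Require Import Defs.
From HB Require Import structures.
From mathcomp Require Import all_boot all_order all_algebra.
From mathcomp Require Import all_classical all_reals all_analysis.
From mathcomp Require Import measurable_realfun ring lra.
Import Order.TTheory GRing.Theory Num.Theory.
Local Open Scope classical_set_scope.
Local Open Scope ring_scope.

(** * Rankings when one document strictly wins until its copies run out *)

Section RankingPrefix.
Context {R : realType} {k n : nat}.
Variables (f : k.-tuple R -> seq (k.-tuple R) -> R) (x : 'I_n -> k.-tuple R).
Variable m : k.-tuple R.

(** [enum 'I_n] is increasing, so this list already follows the tie-breaking order. *)
Definition players_at : seq 'I_n := [seq j <- enum 'I_n | x j == m].

Lemma mem_players_at (j : 'I_n) : (j \in players_at) = (x j == m).
Proof. by rewrite mem_filter mem_enum andbT. Qed.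

Lemma players_at_uniq : uniq players_at.
Proof. by rewrite filter_uniq// enum_uniq. Qed.

Lemma size_players_at : (size players_at <= n)%N.
Proof. by rewrite size_filter (leq_trans (count_size _ _))// size_enum_ord. Qed.

Lemma map_take_players_at (t : nat) : (t <= size players_at)%N ->
  map x (take t players_at) = nseq t m.
Proof.
move=> ht; rewrite -[in RHS](size_takel ht) -(size_map x); apply/all_pred1P.
by apply/allP => _ /mapP[j /mem_take + ->]; rewrite mem_players_at.
Qed.

(** Minimality required by the tie-breaking rule: indices increase strictly along [players_at], and
    a member outside the first [t] entries sits at position [t] or later. *)
Lemma nth_players_at_le (i0 j : 'I_n) (t : nat) :
  j \in players_at -> j \notin take t players_at ->
  (nth i0 players_at t <= j)%N.
Proof.
move=> jM jt.
have sM : sorted ltn (map val players_at).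
  apply: (@subseq_sorted _ ltn ltn_trans _ (map val (enum 'I_n))).
    by rewrite map_subseq// filter_subseq.
  by rewrite val_enum_ord iota_ltn_sorted.
have tj : (t <= index j players_at)%N.
  by rewrite leqNgt; apply: contra jt => h; rewrite in_take.
have jlt : (index j players_at < size players_at)%N by rewrite index_mem.
rewrite -[in leqRHS](nth_index i0 jM).
move: tj; rewrite leq_eqVlt => /predU1P[->//|tj].
have := sorted_ltn_nth ltn_trans 0%N sM.
move=> /(_ t (index j players_at)); rewrite !inE !size_map.
move=> /(_ (ltn_trans tj jlt) jlt tj); rewrite !(nth_map i0)//.
  exact: ltnW.
exact: ltn_trans tj jlt.
Qed.

(** Contexts made of copies of [m] suffice: no others occur before [players_at] is exhausted. *)
Hypothesis f_lt : forall (c : nat) (j : 'I_n),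
  x j != m -> f (x j) (nseq c m) < f m (nseq c m).

(** Induction on [t]: the context is [t] copies of [m], so any remaining publisher at [m] beats all
    those elsewhere, and ties among them go to the smallest index, which is entry [t]. *)
Lemma ranked_players_at (t : nat) : (t <= size players_at)%N ->
  ranked f x t = take t players_at.
Proof.
elim: t => [|t IH] tM /=; first by rewrite take0.
rewrite {}IH; last exact: ltnW.
have i0 : 'I_n by case: players_at tM.
set p := nth i0 players_at t.
have pM : p \in players_at by rewrite mem_nth.
have pt : p \notin take t players_at.
  by rewrite in_take// index_uniq ?players_at_uniq// ltnn.
have xp : x p = m by apply/eqP; rewrite -mem_players_at.
suff -> : next_publisher f x (take t players_at) = Some p.
  by rewrite (take_nth i0 tM).
(* [pickP] returns some index meeting the condition; testing it against [p] forces it to be [p]. In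
   the other branch, [p] itself meets the condition. *)
rewrite /next_publisher; case: pickP => [i /andP[it /forallP imax]|none].
  congr Some; move: (imax p); rewrite pt /= map_take_players_at ?(ltnW tM)// xp.
  have [xi|xi] := eqVneq (x i) m.
    rewrite xi ltxx eqxx /= => ip; apply/val_inj/eqP.
    by rewrite eqn_leq ip nth_players_at_le// mem_players_at xi.
  by have := f_lt t i xi => h; rewrite ltNge (ltW h) (gt_eqF h).
have /negP[] := none p; rewrite pt /=; apply/forallP => j; apply/implyP => jt.
rewrite map_take_players_at ?(ltnW tM)// xp.
have [xj|xj] := eqVneq (x j) m; last by rewrite f_lt.
by rewrite xj eqxx nth_players_at_le ?orbT// mem_players_at xj.
Qed.

Lemma ranking_players_at : exists s, ranking f x = players_at ++ s.
Proof.
(* Further rounds only append at the end, or change nothing when no publisher is found. *)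
have ranked_cat a b : exists s, ranked f x (a + b) = ranked f x a ++ s.
  elim: b => [|b [s IH]]; first by exists [::]; rewrite addn0 cats0.
  rewrite addnS /=; case: next_publisher => [i|] /=; last by exists s.
  by exists (rcons s i); rewrite IH rcons_cat.
have [s] := ranked_cat (size players_at) (n - size players_at)%N.
rewrite subnKC ?size_players_at// (ranked_players_at (size _))//.
rewrite take_oversize// => rankE.
by exists s.
Qed.

Lemma ranked_before_at (i : 'I_n) : x i = m ->
  ranked_before f x i = take (index i players_at) players_at.
Proof.
move=> xi; have iM : i \in players_at by rewrite mem_players_at xi.
rewrite /ranked_before /position; have [s ->] := ranking_players_at.
by rewrite index_cat iM takel_cat// index_size.
Qed.

(** Since [i] is not in [players_at], its index falls past that block, whether or not it occurs in
    the rest of the ranking. *)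
Lemma ranked_before_off (i : 'I_n) : x i <> m ->
  exists s, ranked_before f x i = players_at ++ s.
Proof.
move=> /eqP xi.
have iM : i \notin players_at by rewrite mem_players_at.
rewrite /ranked_before /position; have [s ->] := ranking_players_at.
rewrite index_cat (negPf iM) take_cat ltnNge leq_addr /= addKn.
by exists (take (index i s) s).
Qed.

End RankingPrefix.

(** * Approximation by averages of threshold indicators *)

Lemma step_approx (R : realType) (N : nat) (g : R) : 0 <= g <= 1 ->
  `|g - N.+1%:R^-1 * \sum_(q < N.+1) (q.+1%:R / N.+1%:R <= g)%R%:R| <=
    N.+1%:R^-1.
Proof.
move=> /andP[g0 g1]; have N0 : 0 < N.+1%:R :> R by rewrite ltr0n.
set t := Num.truncn (N.+1%:R * g).
have tN : (t <= N.+1)%N.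
  rewrite -(ler_nat R) (@le_trans _ _ (N.+1%:R * g))// ?truncn_le ?mulr_ge0//.
  by rewrite ger_pMr.
(* The thresholds not exceeding [g] are those with [q.+1 <= N.+1 * g], so their number is the
   integer part [t]; [tN] ensures that none is missed by the range of [q]. *)
have -> : \sum_(q < N.+1) (q.+1%:R / N.+1%:R <= g)%R%:R = t%:R :> R.
  rewrite -[in RHS](card_ord t) -[RHS]sumr_const big_mkcond/=.
  rewrite (big_ord_widen _ (fun=> 1) tN) [RHS]big_mkcond/=.
  apply: eq_bigr => q _.
  by rewrite ler_pdivrMr// mulrC -truncn_gt_nat; case: ltnP.
have /andP[tg gt] := truncn_itv (mulr_ge0 (ltW N0) g0).
rewrite -/t in tg gt.
rewrite -[g in g - _](mulKf (lt0r_neq0 N0)) -mulrBr normrM.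
rewrite gtr0_norm ?invr_gt0//.
rewrite ger_pMr ?invr_gt0// ger0_norm ?subr_ge0//.
by rewrite lerBlDl natr1 ltW.
Qed.

(** * Expectations of measurable functions bounded on the cube *)

Section CubeExpectation.
Context {R : realType} {k : nat} (P : probability (k.-tuple R) R).
Hypothesis P_cube : P (@cube R k) = 1%:E.

(** The bound is asked on the cube only, because similarities are unbounded on the whole space; as
    [P] is carried by the cube, this still gives integrability. *)
Definition cube_bounded (X : k.-tuple R -> R) : Prop :=
  measurable_fun setT X /\ exists C, forall a, cube a -> `|X a| <= C.

Lemma measurable_cube : measurable (@cube R k).
Proof.
have -> : @cube R k =
    \bigcap_(j in [set: 'I_k]) ((tnth (T:=R))^~ j @^-1` `[0, 1]).
  apply/seteqP; split => a /= h j; last by have := h j I; rewrite /= in_itv.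
  by move=> _; rewrite /= in_itv; exact: h.
apply: fin_bigcap_measurable => // j _; rewrite -[X in measurable X]setTI.
by apply: measurable_tnth => //; exact: measurable_itv.
Qed.

Lemma cube_bounded_cst (c : R) : cube_bounded (fun=> c).
Proof. by split; [exact: measurable_cst|exists `|c|]. Qed.

Lemma cube_boundedD (X Y : k.-tuple R -> R) :
  cube_bounded X -> cube_bounded Y -> cube_bounded (fun a => X a + Y a).
Proof.
move=> [mX [C hC]] [mY [D hD]]; split; first exact: measurable_funD.
exists (C + D) => a ca; rewrite (le_trans (ler_normD _ _))// lerD//.
  exact: hC.
exact: hD.
Qed.

Lemma cube_boundedM (X Y : k.-tuple R -> R) :
  cube_bounded X -> cube_bounded Y -> cube_bounded (fun a => X a * Y a).
Proof.
move=> [mX [C hC]] [mY [D hD]]; split; first exact: measurable_funM.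
by exists (C * D) => a ca; rewrite normrM ler_pM ?hC ?hD.
Qed.

Lemma cube_boundedZ (c : R) (X : k.-tuple R -> R) :
  cube_bounded X -> cube_bounded (fun a => c * X a).
Proof. exact/cube_boundedM/cube_bounded_cst. Qed.

Lemma cube_boundedB (X Y : k.-tuple R -> R) :
  cube_bounded X -> cube_bounded Y -> cube_bounded (fun a => X a - Y a).
Proof.
move=> hX hY; apply: cube_boundedD => //.
by under eq_fun do rewrite -mulN1r; exact: cube_boundedZ.
Qed.

Lemma cube_bounded_sum (I : Type) (s : seq I) (X : I -> k.-tuple R -> R) :
  (forall i, cube_bounded (X i)) -> cube_bounded (fun a => \sum_(i <- s) X i a).
Proof.
move=> hX; elim: s => [|i s IH].
  by under eq_fun do rewrite big_nil; exact: cube_bounded_cst.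
by under eq_fun do rewrite big_cons; exact: cube_boundedD.
Qed.

Lemma cube_bounded_prod (I : Type) (s : seq I) (X : I -> k.-tuple R -> R) :
  (forall i, cube_bounded (X i)) ->
  cube_bounded (fun a => \prod_(i <- s) X i a).
Proof.
move=> hX; elim: s => [|i s IH].
  by under eq_fun do rewrite big_nil; exact: cube_bounded_cst.
by under eq_fun do rewrite big_cons; exact: cube_boundedM.
Qed.

Lemma cube_boundedX (n : nat) (X : k.-tuple R -> R) :
  cube_bounded X -> cube_bounded (fun a => X a ^+ n).
Proof.
move=> hX; elim: n => [|n IH]; first exact: cube_bounded_cst.
by under eq_fun do rewrite exprS; exact: cube_boundedM.
Qed.

Lemma cube_bounded_indic (A : set (k.-tuple R)) :
  measurable A -> cube_bounded \1_A.
Proof.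
move=> mA; split; first exact: measurable_indic.
by exists 1 => a _; rewrite indicE; case: (_ \in _); rewrite ?normr1 ?normr0.
Qed.

Lemma cube_bounded_tnth (j : 'I_k) : cube_bounded (fun a => tnth a j).
Proof.
split; first exact: measurable_tnth.
by exists 1 => a /(_ j) /andP[a0 a1]; rewrite ger0_norm.
Qed.

Lemma P_setC_cube : P (~` @cube R k) = 0%E.
Proof. by rewrite probability_setC ?P_cube ?subee//; exact: measurable_cube. Qed.

Lemma cube_bounded_integrable_cube (X : k.-tuple R -> R) :
  cube_bounded X -> P.-integrable (@cube R k) (EFin \o X).
Proof.
move=> [mX [C hC]]; apply: measurable_bounded_integrable => //.
- exact: measurable_cube.
- by rewrite [X in (X < _)%E]P_cube ltry.
- exact: measurable_funS mX.
- exists C; split; first exact: num_real.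
  move=> M CM a ca.
  by rewrite /= (le_trans (hC a ca))// ltW.
Qed.

Lemma cube_bounded_integrable (X : k.-tuple R -> R) :
  cube_bounded X -> P.-integrable setT (EFin \o X).
Proof.
move=> hX; apply/(@negligible_integrable _ _ _ _ _ (~` @cube R k)) => //.
- apply: measurableC; exact: measurable_cube.
- by case: hX => mX _; exact/measurable_EFinP.
- exact: P_setC_cube.
- by rewrite setDE setTI setCK; exact: cube_bounded_integrable_cube.
Qed.

Lemma ExE (X : k.-tuple R -> R) : Ex P X = \int[P]_a X a.
Proof. by rewrite /Ex unlock. Qed.

(** The complement of the cube is null. This lets inequalities between expectations be checked on
    the cube alone. *)
Lemma Ex_cube (X : k.-tuple R -> R) :
  cube_bounded X -> Ex P X = \int[P]_(a in @cube R k) X a.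
Proof.
move=> hX; rewrite ExE /Rintegral.
rewrite (@negligible_integral _ _ _ _ _ (~` @cube R k))//.
- by rewrite setDE setTI setCK.
- apply: measurableC; exact: measurable_cube.
- exact: cube_bounded_integrable.
- exact: P_setC_cube.
Qed.

Lemma ExD (X Y : k.-tuple R -> R) : cube_bounded X -> cube_bounded Y ->
  Ex P (fun a => X a + Y a) = Ex P X + Ex P Y.
Proof.
by move=> hX hY; rewrite !ExE RintegralD//; exact: cube_bounded_integrable.
Qed.

Lemma ExZ (c : R) (X : k.-tuple R -> R) : cube_bounded X ->
  Ex P (fun a => c * X a) = c * Ex P X.
Proof.
by move=> hX; rewrite !ExE RintegralZl//; exact: cube_bounded_integrable.
Qed.

Lemma ExB (X Y : k.-tuple R -> R) : cube_bounded X -> cube_bounded Y ->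
  Ex P (fun a => X a - Y a) = Ex P X - Ex P Y.
Proof.
by move=> hX hY; rewrite !ExE RintegralB//; exact: cube_bounded_integrable.
Qed.

Lemma Ex_sum (I : Type) (s : seq I) (X : I -> k.-tuple R -> R) :
  (forall i, cube_bounded (X i)) ->
  Ex P (fun a => \sum_(i <- s) X i a) = \sum_(i <- s) Ex P (X i).
Proof.
move=> hX; elim: s => [|i s IH].
  under eq_fun do rewrite big_nil.
  by rewrite big_nil ExE Rintegral_cst// mul0r.
under eq_fun do rewrite big_cons.
by rewrite big_cons ExD ?IH//; exact: cube_bounded_sum.
Qed.

Lemma Ex_cst (c : R) : Ex P (fun=> c) = c.
Proof. by rewrite ExE Rintegral_cst// [X in fine X]probability_setT mulr1. Qed.

Lemma le_Ex (X Y : k.-tuple R -> R) : cube_bounded X -> cube_bounded Y ->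
  (forall a, cube a -> X a <= Y a) -> Ex P X <= Ex P Y.
Proof.
move=> hX hY XY; rewrite !Ex_cube//; apply: le_Rintegral => //.
- exact: measurable_cube.
- exact: cube_bounded_integrable_cube.
- exact: cube_bounded_integrable_cube.
Qed.

Lemma Ex_ge0 (X : k.-tuple R -> R) : cube_bounded X ->
  (forall a, cube a -> 0 <= X a) -> 0 <= Ex P X.
Proof. by move=> hX X0; rewrite -(Ex_cst 0) le_Ex//; exact: cube_bounded_cst. Qed.

(** A nonnegative function with zero integral vanishes almost everywhere, so its zero set would have
    probability 1. *)
Lemma Ex_gt0 (X : k.-tuple R -> R) : cube_bounded X ->
  (forall a, cube a -> 0 <= X a) -> P [set a | X a = 0] <> 1%:E ->
  0 < Ex P X.
Proof.
move=> hX X0 PX; have [mX _] := hX.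
have mX0 : measurable [set a | X a = 0].
  rewrite -[X in measurable X]setTI.
  exact: (mX measurableT _ (measurable_set1 0)).
rewrite lt_neqAle Ex_ge0// andbT; apply/eqP => /esym EX0; apply: PX.
have [N [mN PN subN]] : ae_eq P (@cube R k) (EFin \o X) (cst 0%E).
  apply/ae_eq_integral_abs.
  - exact: measurable_cube.
  - by apply/measurable_EFinP; exact: measurable_funS mX.
  rewrite (_ : (\int[P]_(a in _) _)%E =
      (\int[P]_(a in @cube R k) (X a)%:E)%E); last first.
    by apply: eq_integral => a; rewrite inE => ca /=; rewrite ger0_norm// X0.
  rewrite -[LHS]fineK; last first.
    apply: integrable_fin_num; [exact: measurable_cube|].
    exact: cube_bounded_integrable_cube.
  by rewrite -[fine _]/(Rintegral _ _ _) -Ex_cube// EX0.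
have PXC : P (~` [set a | X a = 0]) = 0%E.
  (* Where [X] is nonzero, the point lies either in the exceptional set [N] or outside the cube, and
     both are null. *)
  apply: (@subset_measure0 _ _ _ P _ (N `|` ~` @cube R k)).
  - exact: measurableC.
  - by apply: measurableU => //; apply: measurableC; exact: measurable_cube.
  - move=> a /= Xa; have [ca|] := pselect (cube a); [left|by right].
    by apply: subN => /= /(_ ca) [].
  - rewrite [LHS]measureU0//; last exact: P_setC_cube.
    by apply: measurableC; exact: measurable_cube.
by rewrite -[X in P X]setCK probability_setC ?PXC ?sube0//; exact: measurableC.
Qed.

(* A function with values in [0, 1] is uniformly approximated by averages of
   indicators of its superlevel sets, on which [X] integrates as [mu]. *)
Lemma Ex_cond_expectation_cst (X Y : k.-tuple R -> R) (mu : R) (h : R -> R) :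
  cube_bounded X -> cond_expectation P X Y (fun=> mu) ->
  measurable_fun setT h -> measurable_fun setT (h \o Y) ->
  (forall a, cube a -> 0 <= h (Y a) <= 1) ->
  Ex P (fun a => X a * h (Y a)) = mu * Ex P (h \o Y).
Proof.
move=> hX [_ _ _ XY] mh mhY h01.
have hG : cube_bounded (h \o Y).
  split=> //; exists 1 => a ca /=; have /andP[h0 h1] := h01 _ ca.
  by rewrite ger0_norm.
have hH : cube_bounded (fun a => X a - mu).
  exact/cube_boundedB/cube_bounded_cst.
have [C HC] : exists C, forall a, cube a -> `|X a - mu| <= C by case: hH.
(* Centring [X] turns the claim into the vanishing of a single expectation. *)
suff : Ex P (fun a => (X a - mu) * h (Y a)) = 0.
  under eq_fun do rewrite mulrBl.
  rewrite ExB ?ExZ//; [|exact: cube_boundedM|exact: cube_boundedZ].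
  exact: subr0_eq.
(* Superlevel sets of [h \o Y], written as preimages under [Y] so that the identity defining the
   conditional expectation applies to them. *)
pose A (N q : nat) : set (k.-tuple R) :=
  Y @^-1` (h @^-1` `[q.+1%:R / N.+1%:R, +oo[).
have mhB (N q : nat) : measurable (h @^-1` `[q.+1%:R / N.+1%:R, +oo[).
  by rewrite -[X in measurable X]setTI; apply: mh => //; exact: measurable_itv.
have mA (N q : nat) : measurable (A N q).
  rewrite /A -comp_preimage -[X in measurable X]setTI.
  by apply: mhY => //; exact: measurable_itv.
have H0 N q : Ex P (fun a => (X a - mu) * \1_(A N q) a) = 0.
  have hA := cube_bounded_indic _ (mA N q).
  under eq_fun do rewrite mulrBl.
  rewrite ExB; [|exact: cube_boundedM|exact: cube_boundedZ].
  have int_indic (Z : k.-tuple R -> R) :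
      Ex P (fun a => Z a * \1_(A N q) a) = \int[P]_(a in A N q) Z a.
    rewrite ExE [RHS]Rintegral_mkcond; apply: eq_Rintegral => a _.
    by rewrite patchE indicE; case: ifP; rewrite ?mulr1 ?mulr0.
  by rewrite !int_indic /Rintegral XY// subrr.
(* [phi] is within [N.+1%:R^-1] of [h \o Y] on the cube, [X - mu] is bounded there by [C], and [phi]
   contributes nothing by [H0]. *)
have bound N : `|Ex P (fun a => (X a - mu) * h (Y a))| <= C * N.+1%:R^-1.
  pose phi a := N.+1%:R^-1 * \sum_(q < N.+1) \1_(A N q) a : R.
  have hphi : cube_bounded phi.
    by apply/cube_boundedZ/cube_bounded_sum => q; exact: cube_bounded_indic.
  have phi0 : Ex P (fun a => (X a - mu) * phi a) = 0.
    have -> : (fun a => (X a - mu) * phi a) =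
        (fun a => N.+1%:R^-1 * \sum_(q < N.+1) (X a - mu) * \1_(A N q) a).
      by apply/funext => a; rewrite /phi mulrCA -mulr_sumr.
    rewrite ExZ ?Ex_sum ?big1 ?mulr0//.
    - by move=> q; apply: cube_boundedM => //; exact: cube_bounded_indic.
    - apply: cube_bounded_sum => q; apply: cube_boundedM => //.
      exact: cube_bounded_indic.
  rewrite -[X in `|X|]subr0 -phi0 -ExB; [|exact: cube_boundedM..].
  have hD : cube_bounded (fun a => (X a - mu) * h (Y a) - (X a - mu) * phi a).
    by apply: cube_boundedB; exact: cube_boundedM.
  have close a : cube a ->
      `|(X a - mu) * h (Y a) - (X a - mu) * phi a| <= C * N.+1%:R^-1.
    move=> ca; rewrite -mulrBr normrM ler_pM ?HC//.
    rewrite (le_trans _ (step_approx _ N _ (h01 a ca)))// le_eqVlt.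
    apply/orP; left; apply/eqP; congr (`|_ - _ * _|).
    apply: eq_bigr => q _; rewrite indicE; congr (nat_of_bool _)%:R.
    by apply/idP/idP; rewrite inE /A /= in_itv/= andbT.
  rewrite ler_norml -[X in X <= _]Ex_cst -[X in _ && (_ <= X)]Ex_cst.
  by apply/andP; split; apply: le_Ex => //; (try exact: cube_bounded_cst) => a /close;
    rewrite ler_norml => /andP[].
apply: contrapT => /eqP; rewrite -normr_gt0 => e0.
(* With e the supposedly positive absolute value, this N satisfies N + 1 > C / e, contradicting e <=
   C / (N + 1). *)
have := bound (Num.truncn (C / `|Ex P (fun a => (X a - mu) * h (Y a))|)).
rewrite ler_pdivlMr// leNgt => /negP; apply.
by rewrite mulrC -ltr_pdivrMr// truncnS_gt.
Qed.

(** * Similarity as a quadratic function *)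

Lemma similarityE (y a : k.-tuple R) :
  similarity y a = 1 - k%:R^-1 * \sum_(j < k) (tnth y j - tnth a j) ^+ 2.
Proof. by rewrite /similarity sqr_sqrtr// sumr_ge0// => j _; exact: sqr_ge0. Qed.

(** Expansion of |y - a|^2 around [z]; the middle term is |y - z|^2 / k. *)
Lemma similarity_shift (y z a : k.-tuple R) :
  similarity y a = similarity z a - (1 - similarity y z) -
    2 * k%:R^-1 * \sum_(j < k) (tnth y j - tnth z j) * (tnth z j - tnth a j).
Proof.
rewrite !similarityE.
have -> : \sum_(j < k) (tnth y j - tnth a j) ^+ 2 =
    \sum_(j < k) (tnth z j - tnth a j) ^+ 2 +
    \sum_(j < k) (tnth y j - tnth z j) ^+ 2 +
    2 * \sum_(j < k) (tnth y j - tnth z j) * (tnth z j - tnth a j).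
  by rewrite mulr_sumr -!big_split; apply: eq_bigr => j _ /=; ring.
ring.
Qed.

Lemma cube_bounded_similarity (y : k.-tuple R) : cube_bounded (similarity y).
Proof.
rewrite (funext (similarityE y)); apply: cube_boundedB.
  exact: cube_bounded_cst.
apply/cube_boundedZ/cube_bounded_sum => j; apply: cube_boundedX.
exact/cube_boundedB/cube_bounded_tnth/cube_bounded_cst.
Qed.

Lemma similarity_itv (y a : k.-tuple R) :
  cube y -> cube a -> 0 <= similarity y a <= 1.
Proof.
move=> cy ca; rewrite similarityE.
have s0 : 0 <= \sum_(j < k) (tnth y j - tnth a j) ^+ 2.
  by rewrite sumr_ge0// => j _; exact: sqr_ge0.
(* In dimension 0 the inverse of [k] is 0 by convention and the similarity is 1. Otherwise each of
   the [k] squares is at most 1 on the cube. *)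
have [k0|k0] := posnP k.
  by rewrite [X in X%:R^-1]k0 invr0 mul0r subr0 ler01 lexx.
rewrite gerBl mulr_ge0// andbT subr_ge0 mulrC ler_pdivrMr ?ltr0n// mul1r.
rewrite -[X in _ <= X%:R](card_ord k) -sumr_const ler_sum// => j _.
have /andP[y0 y1] := cy j; have /andP[a0 a1] := ca j.
nra.
Qed.

Lemma similarity_eq1 (y a : k.-tuple R) :
  (0 < k)%N -> similarity y a = 1 -> y = a.
Proof.
move=> k0; rewrite similarityE => /eqP.
rewrite -subr_eq0 addrAC subrr add0r oppr_eq0 mulf_eq0 invr_eq0.
rewrite pnatr_eq0 gtn_eqF//= psumr_eq0 => [|j _]; last exact: sqr_ge0.
move=> /allP ya; apply/eq_from_tnth => j; apply/eqP.
by rewrite -subr_eq0 -sqrf_eq0; exact: (ya j (mem_index_enum j)).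
Qed.

Lemma cube_mean : cube (mean P).
Proof.
move=> j; rewrite tnth_mktuple Ex_ge0 => [/=||a /(_ j) /andP[]//].
  rewrite -[leRHS](Ex_cst 1) le_Ex => [//|||a /(_ j) /andP[]//].
    exact: cube_bounded_tnth.
  exact: cube_bounded_cst.
exact: cube_bounded_tnth.
Qed.

(** * Consequences of symmetry around the mean *)

Let m := mean P.
Let V (a : k.-tuple R) : R := 1 - similarity m a.

Lemma cube_bounded_VX (c : nat) : cube_bounded (fun a => V a ^+ c).
Proof.
exact/cube_boundedX/cube_boundedB/cube_bounded_similarity/cube_bounded_cst.
Qed.

Lemma VX_itv (c : nat) (a : k.-tuple R) : cube a -> 0 <= V a ^+ c <= 1.
Proof.
move=> ca; have /andP[s0 s1] := similarity_itv _ _ cube_mean ca.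
by rewrite exprn_ge0 ?exprn_ile1// ?subr_ge0// gerBl.
Qed.

Hypothesis P_sym : symmetric_distribution P.

(** [V a ^+ c] depends on [a] only through its distance to [m], and conditionally on that distance
    each coordinate averages to that of [m]. Symmetry is invoked here and enters elsewhere only
    through this identity. *)
Lemma Ex_tnth_VX (j : 'I_k) (c : nat) :
  Ex P (fun a => tnth a j * V a ^+ c) = tnth m j * Ex P (fun a => V a ^+ c).
Proof.
pose h (t : R) := (k%:R^-1 * t ^+ 2) ^+ c.
have hV a : h (Defs.edist m a) = V a ^+ c.
  by rewrite /V /similarity opprB addrCA subrr addr0.
have eV : h \o Defs.edist m = (fun a => V a ^+ c) by apply/funext.
have := @Ex_cond_expectation_cst (fun a => tnth a j) (Defs.edist m) (tnth m j) h
  (cube_bounded_tnth j) (P_sym j).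
under eq_fun do rewrite hV.
rewrite eV; apply.
- apply/measurable_funX/measurable_funM; first exact: measurable_cst.
  exact: exprn_measurable.
- by case: (cube_bounded_VX c).
- by move=> a ca; rewrite hV VX_itv.
Qed.

Lemma Ex_similarity_VX (y : k.-tuple R) (c : nat) :
  Ex P (fun a => similarity y a * V a ^+ c) =
  Ex P (fun a => similarity m a * V a ^+ c) -
    (1 - similarity y m) * Ex P (fun a => V a ^+ c).
Proof.
have hV := cube_bounded_VX c.
have hlin j : cube_bounded (fun a => tnth m j * V a ^+ c - tnth a j * V a ^+ c).
  apply: cube_boundedB; first exact: cube_boundedZ.
  by apply: cube_boundedM => //; exact: cube_bounded_tnth.
have -> : (fun a => similarity y a * V a ^+ c) = (fun a =>
    (similarity m a * V a ^+ c - (1 - similarity y m) * V a ^+ c) -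
    \sum_(j < k) 2 * k%:R^-1 * (tnth y j - tnth m j) *
      (tnth m j * V a ^+ c - tnth a j * V a ^+ c)).
  apply/funext => a; rewrite (similarity_shift y m) [LHS]mulrBl mulrBl;
  congr (_ - _).
  rewrite mulr_sumr mulr_suml; apply: eq_bigr => j _; ring.
rewrite ExB; last 2 first.
- apply: cube_boundedB; last exact: cube_boundedZ.
  by apply: cube_boundedM => //; exact: cube_bounded_similarity.
- by apply: cube_bounded_sum => j; exact: cube_boundedZ.
rewrite ExB; last 2 first.
- by apply: cube_boundedM => //; exact: cube_bounded_similarity.
- exact: cube_boundedZ.
rewrite ExZ// Ex_sum => [|j]; last exact: cube_boundedZ.
(* Each coordinate of the cross term has zero expectation against [V a ^+ c]. *)
rewrite big1 ?subr0// => j _.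
rewrite ExZ// ExB ?ExZ// ?Ex_tnth_VX ?subrr ?mulr0//.
  exact: cube_boundedZ.
by apply: cube_boundedM => //; exact: cube_bounded_tnth.
Qed.

Lemma prod_nseq_mean (c : nat) (a : k.-tuple R) :
  \prod_(z <- nseq c m) (1 - similarity z a) = V a ^+ c.
Proof. by rewrite big_nseq iter_mulr_1. Qed.

Hypothesis k_gt0 : (0 < k)%N.

(** The relevance term gives the strict inequality, as it drops by [lambda] times |y - m|^2 / k; the
    diversity term can only drop as well. *)
Lemma xQuAD_score_lt_mean (lambda : R) (c : nat) (y : k.-tuple R) :
  0 < lambda < 1 -> cube y -> y != m ->
  xQuAD_score lambda P y (nseq c m) < xQuAD_score lambda P m (nseq c m).
Proof.
move=> /andP[l0 l1] cy ym.
have sy : 0 < 1 - similarity y m.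
  have /andP[_ s1] := similarity_itv _ _ cy cube_mean.
  rewrite subr_gt0 lt_neqAle s1 andbT; apply: contra_neq ym.
  exact: similarity_eq1.
rewrite /xQuAD_score.
under [in ltLHS]eq_fun do rewrite prod_nseq_mean.
under [in ltRHS]eq_fun do rewrite prod_nseq_mean.
(* The case c = 0 of [Ex_similarity_VX], where the weight is constantly 1. *)
have Ex_similarity :
    Ex P (similarity y) = Ex P (similarity m) - (1 - similarity y m).
  have mulV0 (X : k.-tuple R -> R) : (fun a => X a * V a ^+ 0) = X.
    by apply/funext => a; rewrite mulr1.
  have := Ex_similarity_VX y 0; rewrite !mulV0 => ->.
  by rewrite [X in _ * X]Ex_cst mulr1.
rewrite Ex_similarity Ex_similarity_VX.
apply: ltr_leD.
  by rewrite ltr_pM2l// gtrBl.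
rewrite ler_pM2l ?subr_gt0// gerBl mulr_ge0 ?(ltW sy)// Ex_ge0//.
  exact: cube_bounded_VX.
by move=> a /(VX_itv c) /andP[].
Qed.

End CubeExpectation.

(** * Comparison of the two utilities *)

Theorem theorem1 (R : realType) (n k : nat) (hn : (1 <= n)%N) (hk : (1 <= k)%N)
    (lambda : R) (hlambda : 0 < lambda < 1)
    (P : probability (k.-tuple R) R)
    (hX : P (@cube R k) = 1%:E)
    (hsym : symmetric_distribution P)
    (hP : ~ exists c : k.-tuple R, P [set c] = 1%:E) :
  forall i : 'I_n, dominant_strategy (@xQuAD_utility R k n lambda P) i (mean P).
Proof.
move=> i; split; first exact: cube_mean.
move=> y cy ym x cx; set m := mean P.
have cm : cube m by exact: cube_mean.
pose V (a : k.-tuple R) : R := 1 - similarity m a.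
have V01 c a : cube a -> 0 <= V a ^+ c <= 1 by exact: VX_itv.
have hV c : cube_bounded (fun a => V a ^+ c) by exact: cube_bounded_VX.
have hs z : cube_bounded (similarity z) by exact: cube_bounded_similarity.
pose x1 := [eta x with i |-> m]; pose x2 := [eta x with i |-> y].
have cube_dev z j : cube z -> cube ([eta x with i |-> z] j).
  by move=> cz /=; case: eqVneq => // ji; exact: cx.
have score_lt z : cube z -> forall (c : nat) (j : 'I_n),
    [eta x with i |-> z] j != m ->
    xQuAD_score lambda P ([eta x with i |-> z] j) (nseq c m) <
    xQuAD_score lambda P m (nseq c m).
  by move=> cz c j; apply: xQuAD_score_lt_mean => //; exact: cube_dev.
have x1i : x1 i = m by rewrite /x1 /= eqxx.
have x2i : x2 i = y by rewrite /x2 /= eqxx.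
rewrite /xQuAD_utility -/x1 -/x2 x1i x2i.
(* Positions start at 0, so [r] is the number of other publishers at [m] with smaller index than
   [i]. *)
set r := index i (players_at x1 m).
have u1 : Ex P (fun a => similarity m a *
      \prod_(j <- ranked_before (xQuAD_score lambda P) x1 i)
        (1 - similarity (x1 j) a)) =
    Ex P (fun a => similarity m a * V a ^+ r).
  congr (Ex P _); apply/funext => a; congr (_ * _).
  rewrite (ranked_before_at _ x1 m (score_lt m cm))//.
  rewrite -(big_map x1 xpredT (fun z => 1 - similarity z a)).
  by rewrite map_take_players_at ?index_size// prod_nseq_mean.
have [s before2] : exists s, ranked_before (xQuAD_score lambda P) x2 i =
    players_at x2 m ++ s.
  by apply: ranked_before_off; [exact: score_lt|rewrite x2i].
set c := size (players_at x2 m).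
(* The publishers listed before [i] in the first profile differ from [i], so they play [m] in the
   second profile too. *)
have rc : (r <= c)%N.
  rewrite -[r](size_takel (index_size i (players_at x1 m))).
  apply: uniq_leq_size; first by rewrite take_uniq// players_at_uniq.
  move=> j jr; have := mem_take jr; rewrite !mem_players_at /x1 /x2 /=.
  have [ji|//] := eqVneq j i; move: jr; rewrite ji in_take ?ltnn//.
  by rewrite mem_players_at x1i.
have u2 : Ex P (fun a => similarity y a *
      \prod_(j <- ranked_before (xQuAD_score lambda P) x2 i)
        (1 - similarity (x2 j) a)) <= Ex P (fun a => similarity y a * V a ^+ c).
  apply: le_Ex => // [||a ca].
  - apply: cube_boundedM => //; apply: cube_bounded_prod => j.
    by apply: cube_boundedB => //; exact: cube_bounded_cst.
  - exact: cube_boundedM.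
  have /andP[s0 _] := similarity_itv _ _ cy ca; rewrite ler_wpM2l//.
  rewrite before2 big_cat/= -(big_map x2 xpredT (fun z => 1 - similarity z a)).
  rewrite -(take_size (players_at x2 m)) map_take_players_at// prod_nseq_mean.
  have /andP[V0 _] := V01 c a ca; rewrite ler_piMr//.
  apply: prodr_ile1 => j _.
  have /andP[sj0 sj1] := similarity_itv _ _ (cube_dev y j cy) ca.
  by rewrite subr_ge0 sj1 gerBl.
have EVc : 0 < Ex P (fun a => V a ^+ c).
  apply: Ex_gt0 => // [a /(V01 c) /andP[]//|PV]; apply: hP; exists m.
  (* For c = 0 the weight is 1 and its zero set is empty, hence not of probability 1. For c > 0 the
     zero set is the singleton of [m], which would carry all the mass. *)
  case: (c) PV => [|c']; first rewrite (_ : [set _ | _] = set0).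
  - by rewrite measure0 => /eqP; rewrite eqe eq_sym oner_eq0.
  - by apply/seteqP; split => // a /eqP; rewrite /= oner_eq0.
  move=> <-; congr (P _); apply/seteqP; split => [_ ->|a /eqP] /=.
    rewrite /V similarityE big1 ?mulr0 ?subr0 ?subrr ?expr0n// => j _.
    by rewrite subrr expr0n.
  by rewrite expf_eq0/= subr_eq0 => /eqP/esym/(similarity_eq1 _ _ hk).
(* Moving from [y] to [m] at the same exponent [c] gains strictly; lowering the exponent from [c] to
   [r] then loses nothing, since [V] lies in [0, 1] on the cube. *)
rewrite u1 (le_lt_trans u2)// Ex_similarity_VX// (@lt_le_trans _ _
  (Ex P (fun a => similarity m a * V a ^+ c)))//.
  rewrite gtrBl mulr_gt0// subr_gt0.
  have /andP[_ s1] := similarity_itv _ _ cy cm.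
  rewrite lt_neqAle s1 andbT; apply/eqP => /(similarity_eq1 _ _ hk).
  exact: ym.
apply: le_Ex => // [||a ca].
- exact: cube_boundedM.
- exact: cube_boundedM.
have /andP[s0 _] := similarity_itv _ _ cm ca; rewrite ler_wpM2l//.
by have := V01 1 a ca; rewrite expr1 => /andP[V0 V1]; rewrite ler_wiXn2l.
Qed.
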